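(* Let $\mu>0$ and $J\geq 8e$, let $c\geq 256e/J$, and set $T=cJ^2\mu$ and $J_1=J/(8e)$. Then \[ \mathrm{C}^*_J(\mu,T)\leq 32\,c^{-1}\min\{J_1^{-2},\,J_1^{-\sqrt{T}/16}\}. \]
   Context: For a finite set $V$, $p\in[0,1]$ and $\mathcal{A}\subseteq 2^V$, the cost of $\mathcal{A}$ is $\mathrm{C}(\mathcal{A})=\sum_{S\in\mathcal{A}}p^{|S|}$ (with $p^0=1$). $\mathcal{A}$ covers $\mathcal{B}\subseteq 2^V$ if every member of $\mathcal{B}$ contains some member of $\mathcal{A}$; $\mathcal{B}$ can be covered at cost $\gamma$ if some $\mathcal{A}$ covering $\mathcal{B}$ has $\mathrm{C}(\mathcal{A})\le\gamma$. For a simple graph $G$ on $V$ (viewed as its edge set, so $|G|$ is the number of edges), $d_v$ is the degree of $v$, $G[U]$ is the set of edges with both ends in $U$, and $|D_G(U)|=\frac12\sum_{v\in U}d_v$. Define $\mathrm{C}^*_J(\mu,T)$ to be the infimum of those $\gamma$ such that for every finite set $V$, every $p\in[0,1]$ and every simple graph $G$ on $V$ with $|G|p^2\leq\mu$, the family \[ \{U\subseteq V:\ |G[U]|\geq\max\{T,\ J|D_G(U)|p\}\} \] can be covered (with respect to $p$) at cost $\gamma$. *)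

(* Defs.v *)
From HB Require Import structures.
From mathcomp Require Import all_boot all_order all_algebra.
From mathcomp Require Import all_classical all_reals all_analysis.

Set Implicit Arguments.
Unset Strict Implicit.
Unset Printing Implicit Defensive.

Import Order.TTheory GRing.Theory Num.Theory.

Local Open Scope ring_scope.

Section Cover.
Variables (R : realType) (V : finType).
Implicit Types (A B : {set {set V}}) (U : {set V}).

Definition cost (p : R) A : R := \sum_(S in A) p ^+ #|S|.

Definition covers A B : Prop :=
  forall U, U \in B -> exists2 S, S \in A & S \subset U.

Definition coverable (p : R) B (gamma : R) : Prop :=
  exists2 A, covers A B & cost p A <= gamma.

End Cover.

Section Graph.
Variables (R : realType) (V : finType).
Implicit Types (G : {set {set V}}) (U : {set V}).

(* A simple graph on V is its edge set, a set of two-element subsets of V. *)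
Definition simple_graph G : Prop := forall e, e \in G -> #|e| = 2%N.

Definition degree G (v : V) : nat := #|[set e in G | v \in e]%SET|.

Definition induced_edges G U : {set {set V}} := [set e in G | e \subset U]%SET.

(* |D_G(U)|, a half-integer in general. *)
Definition half_degree_sum G U : R := 2^-1 * \sum_(v in U) (degree G v)%:R.

Definition dense_family (J T p : R) G : {set {set V}} :=
  [set U : {set V} | Num.max T (J * half_degree_sum G U * p)
                     <= #|induced_edges G U|%:R]%SET.

End Graph.

(* The infimum is taken in the extended reals, so that it is +oo when no
   gamma is admissible (the infimum of the empty set over R would be 0). *)
Definition Cstar (R : realType) (J mu T : R) : \bar R :=
  ereal_inf [set gamma%:E | gamma in
    [set gamma : R |
      forall (V : finType) (p : R) (G : {set {set V}}),
        0 <= p <= 1 -> simple_graph G -> #|G|%:R * p ^+ 2 <= mu ->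
        coverable p (dense_family J T p G) gamma]]%classic.

(* Main.v *)
(* If T <= 1024, the edges of G cover the family at cost at most mu = T/(cJ^2).
   If T > 1024, every U of the family contains vertex-disjoint stars with
   k_1, k_2, ... leaves, of which each is heavy (k_i >= J p d_v / 4 at the center
   v), with k_1^2 + k_2^2 + ... >= T/2: repeatedly delete the vertices of low
   degree and remove the closed neighbourhoods of vertices of maximal degree.
   By pigeonhole, U contains for some k <= sqrt T/16 more than
   T/2^(k+3) + sqrt T/(8k) disjoint heavy stars with at least k leaves, or one
   with at least sqrt T/16 leaves.
   A Chernoff bound over the leaf sets gives a total cost of at most
   Y_k = T/(2cJk) (2 J1)^-k for the heavy stars with at least k leaves, and a
   second one gives (e Y_k/r)^r for the unions of at least r of them. *)
Require Import Defs.
From HB Require Import structures.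
From mathcomp Require Import all_boot all_order all_algebra.
From mathcomp Require Import all_classical all_reals all_analysis.
From mathcomp Require Import ring lra zify.

Set Implicit Arguments.
Unset Strict Implicit.
Unset Printing Implicit Defensive.

Import Order.TTheory GRing.Theory Num.Theory.

Local Open Scope ring_scope.

(** * Chernoff bound for weighted subsets, and sizes of disjoint unions *)

Lemma expR1_ge2 (R : realType) : 2 <= expR 1 :> R.
Proof. by have := expR_ge1Dx (1 : R); rewrite -[1 + 1]/(2%:R). Qed.

(** Exponential-moment argument: for [t >= 1], each [Q] with at least [m] elements has
    [t ^+ #|Q| / t ^+ m >= 1]. Inserting this factor and summing over all subsets gives the product
    of the [1 + t * w i], at most [expR (t * Y)]. The value [t = m / Y] is optimal. *)
Lemma sum_prod_large_subsets (R : realType) (I : finType) (P : {set I})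
    (w : I -> R) (Y : R) (m : nat) :
  (forall i, 0 <= w i) -> \sum_(i in P) w i <= Y -> Y <= m%:R -> (0 < m)%N ->
  \sum_(Q : {set I} | (Q \subset P) && (m <= #|Q|)%N) \prod_(i in Q) w i
    <= (expR 1 * Y / m%:R) ^+ m.
Proof.
move=> w_ge0 leY Y_le_m m_gt0.
have m_gt0R : 0 < m%:R :> R by rewrite ltr0n.
have Y_ge0 : 0 <= Y by apply: le_trans leY; apply: sumr_ge0.
(* [Y = 0] would make [t] meaningless; here all weights in [P] vanish, and [Q] is nonempty because
   [m > 0]. *)
have [Y0|Y_neq0] := eqVneq Y 0.
  rewrite big1 ?Y0 ?mulr0 ?mul0r ?exprn_ge0 // => Q /andP[QP mQ].
  have /card_gt0P[i iQ] : (0 < #|Q|)%N by apply: leq_trans mQ.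
  rewrite (bigD1 i) //= [w i](_ : _ = 0) ?mul0r //.
  apply/le_anti; rewrite w_ge0 andbT -Y0; apply: le_trans leY.
  rewrite (bigD1 i (fintype.subsetP QP _ iQ)) /= lerDl.
  by apply: sumr_ge0.
have Y_gt0 : 0 < Y by rewrite lt_neqAle eq_sym Y_neq0.
pose t := m%:R / Y.
have t_ge1 : 1 <= t by rewrite /t ler_pdivlMr // mul1r.
have t_gt0 : 0 < t by apply: lt_le_trans t_ge1.
(* Vanishing outside [P] lets the product over the whole type expand into a sum over all subsets. *)
pose v i := if i \in P then t * w i else 0.
have v_ge0 i : 0 <= v i by rewrite /v; case: ifP => // _; rewrite mulr_ge0 // ltW.
have step (Q : {set I}) : (Q \subset P) && (m <= #|Q|)%N ->
    \prod_(i in Q) w i <= t ^- m * \prod_(i in Q) v i.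
  case/andP=> QP mQ.
  have -> : \prod_(i in Q) v i = t ^+ #|Q| * \prod_(i in Q) w i.
    rewrite -prodr_const -big_split /=; apply: eq_bigr => i iQ.
    by rewrite /v ifT ?(fintype.subsetP QP).
  rewrite mulrA ler_peMl ?prodr_ge0 // mulrC ler_pdivlMr ?exprn_gt0 // mul1r.
  by rewrite ler_weXn2l.
apply: le_trans (ler_sum _ step) _.
rewrite -mulr_sumr.
apply: (@le_trans _ _ (t ^- m * expR m%:R)); last first.
  rewrite -[X in expR X]mulr1 expRM_natl -exprVn -exprMn /t invf_div.
  by rewrite mulrC mulrA.
rewrite ler_pM2l ?invr_gt0 ?exprn_gt0 //.
apply: (@le_trans _ _ (\prod_i (v i + 1))).
  rewrite bigA_distr big_mkcond /=; apply: ler_sum => Q _.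
  rewrite -(big_mkcond (fun i => i \in Q)) /=.
  by case: ifP => // _; apply: prodr_ge0.
apply: (@le_trans _ _ (\prod_i expR (v i))).
  by apply: ler_prod => i _; rewrite addr_ge0 ?v_ge0 //= addrC expR_ge1Dx.
rewrite -expR_sum ler_expR -big_mkcond -mulr_sumr /t mulrAC ler_pdivrMr //.
by rewrite ler_pM2l.
Qed.

Lemma sum_card_disjoint (I T : finType) (F : I -> {set T}) (Q : {set I}) :
  {in Q &, forall i j, i != j -> [disjoint F i & F j]} ->
  (\sum_(i in Q) #|F i| <= #|\bigcup_(i in Q) F i|)%N.
Proof.
move=> disjF.
under eq_bigr do rewrite -sum1_card big_mkcond /=.
rewrite exchange_big /= -[leqRHS]sum1_card [leqRHS]big_mkcond /=.
apply: leq_sum => x _.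
case: bigcupP => [[i iQ xi]|noi]; last first.
  by rewrite big1 // => i iQ; case: ifP => // xi; case: noi; exists i.
rewrite (bigD1 i iQ) /= xi big1 // => j /andP[jQ ji].
have := disjF _ _ jQ iQ ji; case: ifP => // xj /disjoint_setI0/setP/(_ x).
by rewrite !inE xi xj.
Qed.

(** * Disjoint stars in a simple graph *)

Section Graphs.
Variables (V : finType) (G : {set {set V}}).
Implicit Types (U N : {set V}) (Q : {set V * {set V}}).

Definition nbr (v : V) : {set V} := [set u | [set v; u]%SET \in G]%SET.

(* A star is encoded as a pair (center, set of leaves). *)
Definition star_support (q : V * {set V}) : {set V} := (q.1 |: q.2)%SET.

(** An edge inside [U] that is lost has an endpoint in [N], and is counted there through its other
    endpoint, a neighbour in [U]. *)
Lemma induced_edges_setD U N :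
  (forall e, e \in G -> exists u v, e = [set u; v]%SET) ->
  (#|induced_edges G U|
     <= #|induced_edges G (U :\: N)| + \sum_(u in N) #|nbr u :&: U|)%N.
Proof.
move=> edgeG.
pose at_vertex u := ([set [set u; x]%SET | x in nbr u :&: U])%SET.
have sub : induced_edges G U \subset
    (induced_edges G (U :\: N) :|: \bigcup_(u in N) at_vertex u)%SET.
  apply/fintype.subsetP => e; rewrite !inE => /andP[eG eU].
  have at_vertexP x y : e = [set x; y]%SET -> x \in N ->
      e \in (\bigcup_(u in N) at_vertex u)%SET.
    move=> exy xN; apply/bigcupP; exists x => //; rewrite exy.
    apply/imsetP; exists y => //.
    by rewrite !inE -exy eG (fintype.subsetP eU) // exy !inE eqxx orbT.
  have [x [y exy]] := edgeG _ eG.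
  have [xN|xN] := boolP (x \in N); first by rewrite (at_vertexP x y) ?orbT.
  have [yN|yN] := boolP (y \in N).
    by rewrite (at_vertexP y x) ?orbT // exy finset.setUC.
  rewrite eG; apply/orP; left; apply/fintype.subsetP => z ze.
  rewrite inE (fintype.subsetP eU _ ze) andbT.
  by move: ze; rewrite exy => /set2P[] ->.
apply: leq_trans (subset_leq_card sub) _.
apply: leq_trans (leq_card_setU _ _).1 _; rewrite leq_add2l.
elim/big_rec2: _ => [|u n A _ le_n]; first by rewrite cards0.
apply: leq_trans (leq_card_setU _ _).1 _; rewrite leq_add //.
exact: leq_imset_card.
Qed.

Hypothesis simpleG : simple_graph G.

Lemma simple_edge e : e \in G -> exists u v, e = [set u; v]%SET.
Proof. by move=> /simpleG/eqP/cards2P[u [v [_ ->]]]; exists u, v. Qed.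

Lemma nbr_irr v : v \notin nbr v.
Proof.
by rewrite inE finset.setUid; apply/negP => /simpleG; rewrite cards1.
Qed.

Lemma card_nbr v : #|nbr v| = degree G v.
Proof.
rewrite /degree.
have -> : [set e in G | v \in e]%SET = ([set [set v; u]%SET | u in nbr v])%SET.
  apply/setP => e; rewrite !inE; apply/andP/imsetP => [[eG ve]|[u]].
    have [x [y exy]] := simple_edge eG.
    move: ve; rewrite exy => /set2P[] ->; [exists y => //|exists x].
    - by rewrite inE -exy.
    - by rewrite inE finset.setUC -exy.
    - exact: finset.setUC.
  by rewrite inE => uv ->; rewrite uv set21.
rewrite card_in_imset // => x y xv yv /setP/(_ x).
rewrite !inE eqxx orbT => /esym/orP[/eqP xvE|/eqP//].
by move: xv; rewrite xvE (negbTE (nbr_irr v)).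
Qed.

Lemma sum_degree : (\sum_v degree G v = 2 * #|G|)%N.
Proof.
under eq_bigr => v _ do rewrite /degree -sum1_card big_mkcond /=.
rewrite exchange_big /= -sum1_card big_distrr /= [RHS]big_mkcond /=.
apply: eq_bigr => e _; case: ifP => eG; last first.
  by rewrite big1 // => v; rewrite inE eG.
under eq_bigr => v _ do rewrite inE eG /=.
by rewrite -big_mkcond sum1_card simpleG.
Qed.

(* Delete a vertex v of degree at most h v if there is one; otherwise remove
   a vertex of maximal degree k together with its neighbours, which destroys
   at most k^2 edges. *)
Lemma disjoint_stars (R : realType) (h : V -> R) U : (forall v, 0 <= h v) ->
  exists Q, [/\ {in Q, forall q : V * {set V}, [/\ q.2 \subset nbr q.1, h q.1 <= #|q.2|%:R,
                                    (0 < #|q.2|)%N & star_support q \subset U]},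
    {in Q &, forall q q' : V * {set V}, q != q' -> [disjoint star_support q & star_support q']}
    & #|induced_edges G U|%:R
        <= (\sum_(q in Q) #|q.2| ^ 2)%N%:R + \sum_(v in U) h v].
Proof.
move=> h_ge0; have [n] := ubnP #|U|; elim: n U => // n IHn U leUn.
have [/existsP[v /andP[vU low]]|] :=
    boolP [exists v, (v \in U) && (#|nbr v :&: U|%:R <= h v)].
  have /IHn[Q [starQ disjQ boundQ]] : (#|U :\ v| < n)%N.
    by move: leUn; rewrite (cardsD1 v) vU.
  exists Q; split => // [q qQ|].
    have [qnbr hq q_gt0 qU] := starQ _ qQ; split=> //.
    exact: fintype.subset_trans qU (subD1set _ _).
  have := induced_edges_setD U [set v]%SET simple_edge.
  rewrite big_set1 -(ler_nat R) natrD => leG; apply: le_trans leG _.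
  by rewrite [leRHS](_ : _ = (\sum_(q in Q) #|q.2| ^ 2)%N%:R +
    \sum_(i in U :\ v) h i + h v) ?lerD // [X in _ + X](big_setD1 v vU) /=; ring.
rewrite negb_exists => /forallP high.
have {}high v : v \in U -> h v < #|nbr v :&: U|%:R.
  by move=> vU; have := high v; rewrite vU /= -ltNge.
have [U0|[v0 v0U]] := set_0Vmem U.
  exists finset.set0; split=> [q|q q'|]; rewrite ?inE //.
  rewrite (_ : induced_edges G U = finset.set0) ?cards0 ?addr_ge0 ?sumr_ge0 //.
  apply/setP => e; rewrite !inE U0 finset.subset0; apply/andP => -[eG /eqP e0].
  by have := simpleG eG; rewrite e0 cards0.
case: (arg_maxnP (fun v => #|nbr v :&: U|) v0U) => v vU maxv.
have {}vU : v \in U := vU.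
set N := (nbr v :&: U)%SET in maxv.
have /IHn[Q [starQ disjQ boundQ]] : (#|U :\: star_support (v, N)| < n)%N.
  apply: leq_trans (leUn : (#|U| <= n)%N); apply: proper_card.
  apply/properP; split; first exact: subsetDl.
  by exists v => //; rewrite !inE eqxx.
have supp_vN q : q \in Q -> [disjoint star_support q & star_support (v, N)].
  by case/starQ => _ _ _; rewrite finset.subsetD => /andP[].
have vN_notin : (v, N) \notin Q.
  apply/negP => /supp_vN; rewrite -setI_eq0 finset.setIid => /eqP/setP/(_ v).
  by rewrite !inE eqxx.
exists ((v, N) |: Q)%SET; split.
- move=> q /setU1P[->|/starQ[? ? ? qU]]; split=> //=.
  + exact: subsetIl.
  + exact/ltW/high.
  + by rewrite -(ltr0n R); apply: le_lt_trans (high _ vU).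
  + by rewrite /star_support finset.subUset finset.sub1set vU subsetIr.
  + exact: fintype.subset_trans qU (subsetDl _ _).
- move=> q q' /setU1P[->|qQ] /setU1P[->|q'Q] neq; rewrite ?eqxx // in neq *.
  + by rewrite disjoint_sym supp_vN.
  + exact: supp_vN.
  + exact: disjQ.
rewrite big_setU1 //=.
(* Removing [v] on top of [N] destroys no further edge, since every edge at [v] inside [U] ends in
   [N]. So only the vertices of [N] are charged, each for at most [#|N|] edges by maximality. *)
have edgesN : induced_edges G (U :\: N) = induced_edges G (U :\: star_support (v, N)).
  apply/setP => e; rewrite !inE; have [eG|//] := boolP (e \in G).
  apply/fintype.subsetP/fintype.subsetP => eU z ze; have := eU z ze; rewrite !inE.
    move=> /andP[zN zU]; rewrite zU andbT negb_or.
    apply/andP; split; last by rewrite zU in zN.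
    apply/negP => /eqP /= zv.
    have [x [y exy]] := simple_edge eG.
    have [w we] : exists2 w, w \in e & w \in nbr v.
      move: ze; rewrite exy => /set2P[zE|zE].
        by exists y; rewrite ?set22 // inE -zv zE -exy.
      by exists x; rewrite ?set21 // inE -zv zE finset.setUC -exy.
    by move=> wv; have := eU w we; rewrite inE => /andP[+ wU]; rewrite finset.in_setI wv wU.
  by rewrite negb_or => /andP[/andP[_ ->] ->].
have leG := induced_edges_setD U N simple_edge.
have leN : (\sum_(u in N) #|nbr u :&: U| <= #|N| ^ 2)%N.
  rewrite -mulnn -sum_nat_const; apply: leq_sum => u; rewrite inE => /andP[_ uU].
  exact: maxv.
have sumh : \sum_(u in U :\: star_support (v, N)) h u <= \sum_(u in U) h u.
  rewrite [leRHS](big_setID (star_support (v, N))) /= lerDr.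
  exact: sumr_ge0.
move: (leq_trans leG (leq_add (leqnn _) leN)); rewrite -(ler_nat R) edgesN.
move=> /le_trans; apply.
rewrite !natrD; move: boundQ sumh; lra.
Qed.

End Graphs.

(** * Subadditivity of the cost, and pigeonhole over star sizes *)

Lemma cost_imset (R : realType) (I V : finType) (p : R) (f : I -> {set V})
    (D : {pred I}) : 0 <= p ->
  cost p (f @: D) <= \sum_(i in D) p ^+ #|f i|.
Proof.
move=> p_ge0; rewrite /cost (partition_big_imset f) /=.
apply: ler_sum => S /imsetP[i iD ->].
by rewrite (bigD1 i) /= ?iD ?eqxx // lerDl sumr_ge0 // => j _; rewrite exprn_ge0.
Qed.

Lemma cost_bigcup (R : realType) (V : finType) (p : R) (n : nat)
    (A : 'I_n -> {set {set V}}) : 0 <= p ->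
  cost p (\bigcup_i A i) <= \sum_i cost p (A i).
Proof.
move=> p_ge0; rewrite /cost.
under [leRHS]eq_bigr do rewrite big_mkcond /=.
rewrite exchange_big /= big_mkcond; apply: ler_sum => S _.
have pS_ge0 : 0 <= p ^+ #|S| by rewrite exprn_ge0.
have term_ge0 i : 0 <= if S \in A i then p ^+ #|S| else 0 by case: ifP.
case: ifP => [/bigcupP[i _ SA]|_]; last exact: sumr_ge0.
by rewrite (bigD1 i) //= SA lerDl sumr_ge0.
Qed.

Lemma sum_odd (n : nat) : (\sum_(i < n) (2 * i + 1) = n ^ 2)%N.
Proof. by elim: n => [|n IHn]; rewrite ?big_ord0 // big_ord_recr /= IHn; lia. Qed.

(* The sum of the squares is [\sum_i (2 i + 1) #{q | i < k q}]. *)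
Lemma sum_squares_pigeonhole (R : realType) (I : finType) (k : I -> nat)
    (Q : {set I}) (n : nat) (b : nat -> R) :
  \sum_(i < n) (2 * i + 1)%N%:R * b i < (\sum_(q in Q) k q ^ 2)%N%:R ->
  (exists2 q, q \in Q & (n < k q)%N) \/
  exists2 i, (i < n)%N & b i < #|[set q in Q | (i < k q)%N]%SET|%:R.
Proof.
move=> lt_sum.
have [/existsP[q /andP[qQ kq]]|/existsPn small] :=
    boolP [exists q, (q \in Q) && (n < k q)%N]; first by left; exists q.
right; have [/existsP[i bi]|/existsPn large] :=
    boolP [exists i : 'I_n, b i < #|[set q in Q | (i < k q)%N]%SET|%:R].
  by exists i.
have layer : (\sum_(q in Q) k q ^ 2 =
    \sum_(i < n) (2 * i + 1) * #|[set q in Q | (i < k q)%N]%SET|)%N.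
  have -> : (\sum_(q in Q) k q ^ 2 =
      \sum_(q in Q) \sum_(i < n) if i < k q then 2 * i + 1 else 0)%N.
    apply: eq_bigr => q qQ; have := small q; rewrite qQ /= -leqNgt => kq.
    by rewrite -sum_odd (big_ord_widen n (fun i => 2 * i + 1)%N kq) big_mkcond.
  rewrite exchange_big /=; apply: eq_bigr => i _.
  rewrite -big_mkcondr /= sum_nat_const mulnC; congr (_ * _)%N.
  by apply: eq_card => q; rewrite !inE.
move: lt_sum; rewrite layer natr_sum ltNge => /negP[].
apply: ler_sum => i _; rewrite natrM ler_wpM2l //.
by rewrite leNgt; exact: large.
Qed.

(** * Costs of heavy stars and of their unions, and the resulting cover *)

Section StarCovers.
Variables (R : realType) (V : finType) (G : {set {set V}}) (p J : R).
Hypotheses (simpleG : simple_graph G) (p01 : 0 <= p <= 1).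
Hypothesis J_ge : 4 * expR 1 <= J.

Let p_ge0 : 0 <= p. Proof. by case/andP: p01. Qed.
Let p_le1 : p <= 1. Proof. by case/andP: p01. Qed.
Let e_ge2 : 2 <= expR 1 :> R := expR1_ge2 R.
Let J_gt0 : 0 < J. Proof. by apply: lt_le_trans J_ge; rewrite mulr_gt0 ?expR_gt0. Qed.

(** With the factor 1/4, the thresholds over [U] add up to half of [J * half_degree_sum G U * p], so
    they absorb at most half of the edges induced by a member of the dense family. *)
Definition threshold (v : V) : R := J * p * (degree G v)%:R / 4.

Definition heavy_stars (k : nat) : {set V * {set V}} :=
  [set q : V * {set V} | [&& q.2 \subset nbr G q.1, (k <= #|q.2|)%N
             & threshold q.1 <= #|q.2|%:R]]%SET.

(** The last condition says that the stars are disjoint, in the form needed to bound the cost of the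
    union by the product of the costs of the stars. *)
Definition star_unions (k r : nat) : {set {set V}} :=
  ([set \bigcup_(q in Q) star_support q | Q : {set V * {set V}} in
     [pred Q : {set V * {set V}} | [&& Q \subset heavy_stars k, (r <= #|Q|)%N
       & (\sum_(q in Q) #|star_support q| <= #|\bigcup_(q in Q) star_support q|)%N]]])%SET.

Lemma threshold_ge0 v : 0 <= threshold v.
Proof. by rewrite /threshold divr_ge0 // !mulr_ge0 // ltW. Qed.

(** Let [m] be the least integer that is at least [k] and at least the threshold. The Chernoff bound
    over the neighbours of [v] gives [(e * Y / m) ^+ m] with [Y] the degree times [p], and
    [threshold v <= m] reads [Y <= 4 / J * m]. *)
Lemma heavy_leaves_cost (k : nat) (v : V) : (0 < k)%N ->
  \sum_(N : {set V} | [&& N \subset nbr G v, (k <= #|N|)%N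
                         & threshold v <= #|N|%:R]) p ^+ #|N|
    <= expR 1 * (degree G v)%:R * p / k%:R * (4 * expR 1 / J) ^+ k.-1.
Proof.
move=> k_gt0.
have exm : exists m, (k <= m)%N && (threshold v <= m%:R).
  exists (maxn k (Num.trunc (threshold v)).+1); rewrite leq_maxl /=.
  apply: (ltW (lt_le_trans (truncnS_gt _) _)).
  by rewrite ler_nat leq_maxr.
case: (ex_minnP exm) => m /andP[km hm] minm.
have m_gt0 : (0 < m)%N by apply: leq_trans km.
have m_gt0R : 0 < m%:R :> R by rewrite ltr0n.
set Y := (degree G v)%:R * p.
have Y_ge0 : 0 <= Y by rewrite mulr_ge0.
have Y_le : Y <= 4 / J * m%:R.
  rewrite mulrAC ler_pdivlMr // -ler_pdivrMl // (le_trans _ hm) //.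
  by rewrite /threshold /Y le_eqVlt; apply/orP; left; apply/eqP; ring.
have J4 : 4 / J <= 1 by rewrite ler_pdivrMr //; move: J_ge e_ge2; lra.
apply: (@le_trans _ _ ((expR 1 * Y / m%:R) ^+ m)).
  have sumY : \sum_(u in nbr G v) p <= Y by rewrite sumr_const card_nbr // /Y mulr_natl.
  have Ym : Y <= m%:R by apply: le_trans Y_le _; rewrite (ler_piMl (ltW m_gt0R) J4).
  have := @sum_prod_large_subsets _ _ _ (fun=> p) _ _ (fun=> p_ge0) sumY Ym m_gt0.
  apply: le_trans.
  rewrite big_mkcond [leRHS]big_mkcond /=; apply: ler_sum => N _.
  rewrite prodr_const; have pN : 0 <= p ^+ #|N| by rewrite exprn_ge0.
  case: ifP => [/and3P[-> kN hN]|_]; last by case: ifP.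
  by rewrite /= minm // kN.
have ratio : expR 1 * Y / m%:R <= 4 * expR 1 / J.
  rewrite ler_pdivrMr //.
  have -> : 4 * expR 1 / J * m%:R = expR 1 * (4 / J * m%:R) by ring.
  by rewrite ler_pM2l ?expR_gt0.
have ratio_le1 : 4 * expR 1 / J <= 1 by rewrite ler_pdivrMr // mul1r.
have ratio_ge0 : 0 <= 4 * expR 1 / J by rewrite divr_ge0 ?ltW // mulr_gt0 ?expR_gt0.
have base_ge0 : 0 <= expR 1 * Y / m%:R by rewrite divr_ge0 // mulr_ge0 // expR_ge0.
(* One factor keeps the degree, so that summing over [v] produces the number of edges; the other
   [m - 1 >= k - 1] factors are each at most [4e/J <= 1]. *)
rewrite -(prednK m_gt0) exprS (prednK m_gt0).
apply: ler_pM => //; first exact: exprn_ge0.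
  rewrite /Y mulrA ler_wpM2l ?mulr_ge0 ?expR_ge0 // lef_pV2 ?posrE ?ltr0n //.
  by rewrite ler_nat.
apply: (@le_trans _ _ ((4 * expR 1 / J) ^+ m.-1)).
  by apply: lerXn2r => //; rewrite nnegrE.
by rewrite ler_wiXn2l // -!subn1 leq_sub2r.
Qed.

(** The center is not among its leaves and contributes one more factor [p]; the degrees then sum to
    twice the number of edges. *)
Lemma heavy_stars_cost (k : nat) : (0 < k)%N ->
  \sum_(q in heavy_stars k) p ^+ #|star_support q|
    <= 2 * expR 1 * (#|G|%:R * p ^+ 2) / k%:R * (4 * expR 1 / J) ^+ k.-1.
Proof.
move=> k_gt0.
have -> : \sum_(q in heavy_stars k) p ^+ #|star_support q| =
    \sum_v p * \sum_(N : {set V} | [&& N \subset nbr G v, (k <= #|N|)%N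
                         & threshold v <= #|N|%:R]) p ^+ #|N|.
  under [RHS]eq_bigr do rewrite mulr_sumr.
  rewrite pair_big_dep /=; apply: eq_big => [q|[v N]]; first by rewrite inE.
  rewrite inE /= => /andP[Nnbr _]; rewrite /star_support /= cardsU1.
  rewrite (contra (fintype.subsetP Nnbr v) (nbr_irr simpleG v)) /=.
  by rewrite exprS.
apply: (@le_trans _ _ (\sum_v p * (expR 1 * (degree G v)%:R * p / k%:R *
    (4 * expR 1 / J) ^+ k.-1))).
  by apply: ler_sum => v _; rewrite ler_wpM2l // heavy_leaves_cost.
rewrite le_eqVlt; apply/orP; left; apply/eqP.
transitivity (p ^+ 2 * (expR 1 / k%:R * (4 * expR 1 / J) ^+ k.-1) *
    (\sum_v degree G v)%N%:R).
  by rewrite natr_sum mulr_sumr; apply: eq_bigr => v _; ring.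
by rewrite sum_degree // natrM; ring.
Qed.

(** Second use of the Chernoff bound, now with whole stars as the elements. *)
Lemma star_unions_cost (k r : nat) (Y : R) : (0 < r)%N ->
  \sum_(q in heavy_stars k) p ^+ #|star_support q| <= Y -> Y <= r%:R ->
  cost p (star_unions k r) <= (expR 1 * Y / r%:R) ^+ r.
Proof.
move=> r_gt0 leY Yr.
have w_ge0 (q : V * {set V}) : 0 <= p ^+ #|star_support q| :> R by rewrite exprn_ge0.
apply: le_trans (cost_imset _ _ p_ge0) _.
apply: le_trans (sum_prod_large_subsets w_ge0 leY Yr r_gt0).
rewrite big_mkcond [leRHS]big_mkcond /=; apply: ler_sum => Q _.
have prod_ge0 : 0 <= \prod_(q in Q) p ^+ #|star_support q| by apply: prodr_ge0.
rewrite inE; case: ifP => [/and3P[-> -> cardQ]|_] /=; last by case: ifP.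
by rewrite prodrXr ler_wiXn2l.
Qed.

(* A single star suffices from size [n.+1] on. *)
Lemma star_unions_cover (T : R) (n : nat) (b : nat -> R) (r : nat -> nat) :
  \sum_(i < n) (2 * i + 1)%N%:R * b i < T / 2 ->
  (forall i m, (i < n)%N -> b i < m%:R -> (r i <= m)%N) -> (r n <= 1)%N ->
  covers (\bigcup_(i < n.+1) star_unions i.+1 (r i))%SET (dense_family J T p G).
Proof.
move=> sum_b r_min rn U; rewrite inE ge_max => /andP[TU DU].
have [Q [starQ disjQ boundQ]] := disjoint_stars simpleG U threshold_ge0.
have Qin (Q' : {set V * {set V}}) (i : 'I_n.+1) : Q' \subset Q ->
    (forall q, q \in Q' -> i < #|q.2|)%N -> (r i <= #|Q'|)%N ->
    exists2 S, S \in (\bigcup_(i < n.+1) star_unions i.+1 (r i))%SET & S \subset U.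
  move=> Q'Q big_leaves rQ'; exists (\bigcup_(q in Q') star_support q)%SET.
    apply/bigcupP; exists i => //; apply/imsetP; exists Q' => //.
    rewrite inE rQ' /=; apply/andP; split.
      apply/fintype.subsetP => q qQ'; rewrite inE big_leaves //=.
      by have [-> ->] := starQ _ (fintype.subsetP Q'Q _ qQ').
    apply: sum_card_disjoint => q q' qQ' q'Q'.
    by apply: disjQ; apply: (fintype.subsetP Q'Q).
  by apply/bigcupsP => q qQ'; have [] := starQ _ (fintype.subsetP Q'Q _ qQ').
have sum_threshold : \sum_(v in U) threshold v <= #|induced_edges G U|%:R / 2.
  have -> : \sum_(v in U) threshold v = J * half_degree_sum R G U * p / 2.
    by rewrite /half_degree_sum -mulr_suml -mulr_sumr; field.
  by rewrite ler_pM2r ?invr_gt0.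
(* At least half of the induced edges, hence at least [T / 2], is left for the squares of the star
   sizes. *)
have lt_squares : \sum_(i < n) (2 * i + 1)%N%:R * b i
    < (\sum_(q in Q) #|q.2| ^ 2)%N%:R.
  by apply: lt_le_trans sum_b _; move: boundQ sum_threshold TU; lra.
have [[q qQ nq]|[i lt_in bi]] := sum_squares_pigeonhole lt_squares.
  apply: (Qin [set q]%SET ord_max); rewrite ?finset.sub1set ?cards1 //.
  by move=> q' /set1P->.
apply: (Qin [set q in Q | (i < #|q.2|)%N]%SET (Ordinal (leqW lt_in))) => /=.
- by apply/fintype.subsetP => q; rewrite inE => /andP[].
- by move=> q; rewrite inE => /andP[].
- exact: r_min lt_in bi.
Qed.

End StarCovers.

(** * Numerical series and estimates *)

Lemma sum_odd_geometric (R : realType) (n : nat) :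
  \sum_(i < n) (2 * i + 1)%N%:R / 2 ^+ i.+1 <= 3 :> R.
Proof.
suff -> : \sum_(i < n) (2 * i + 1)%N%:R / 2 ^+ i.+1 = 3 - (2 * n + 3)%N%:R / 2 ^+ n :> R.
  by rewrite gerBl divr_ge0 // exprn_ge0.
elim: n => [|n IHn]; first by rewrite big_ord0 expr0 divr1 subrr.
rewrite big_ord_recr /= IHn !natrD !natrM -natr1 exprS.
have : 2 ^+ n != 0 :> R by rewrite expf_neq0.
by move=> ?; field.
Qed.

Lemma sum_inv_squares (R : realType) (n : nat) :
  \sum_(i < n) i.+1%:R ^- 2 <= 2 :> R.
Proof.
(* The subtracted term makes the bound inductive, as [2 / (x * (x + 1)) >= x ^- 2] for [x >= 1]. *)
suff : \sum_(i < n) i.+1%:R ^- 2 <= 2 - 2 / n.+1%:R :> R.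
  by move/le_trans; apply; rewrite gerBl divr_ge0.
elim: n => [|n IHn]; first by rewrite big_ord0 divr1 subrr.
rewrite big_ord_recr /=; apply: le_trans (lerD IHn (lexx _)) _.
rewrite -subr_ge0 -(natr1 n.+1).
have n_ge1 : 1 <= n.+1%:R :> R by rewrite ler1n.
set x := n.+1%:R in n_ge1 *.
have -> : 2 - 2 / (x + 1) - (2 - 2 / x + x ^- 2) = (x - 1) / (x ^+ 2 * (x + 1)).
  by field; lra.
by rewrite divr_ge0 ?mulr_ge0 ?exprn_ge0 //; lra.
Qed.

Section Estimates.
Variables (R : realType) (z c T : R).
Hypotheses (z_gt0 : 0 < z) (z_le1 : z <= 1) (c_ge : 32 * z <= c) (T_ge0 : 0 <= T).

Let c_gt0 : 0 < c. Proof. by apply: lt_le_trans c_ge; rewrite mulr_gt0. Qed.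
Let zc_le : z / c <= 32^-1.
Proof. by rewrite ler_pdivrMr //; move: c_ge; lra. Qed.

(* [Y k] is e times the bound on the total cost of the stars with at least
   k leaves, in terms of z = 1 / J1. *)
Let Y (k : nat) := T * z / (16 * c * k%:R) * (z / 2) ^+ k.

(** The hypothesis on [T] bounds [Y k / r] both by [z ^+ k / (64 k)] and by [z ^+ k / (2 c k)]. As
    [r >= 2], one factor of the power can use the second bound and another the first; their product
    supplies [1 / (128 c k^2)], summable in [k]. From the remaining factors only [z ^+ k] is
    kept. *)
Lemma many_stars_estimate (k r : nat) : (0 < k)%N -> (1 < r)%N ->
  T / 2 ^+ k <= 8 * r%:R ->
  Y k / r%:R <= 1 /\
  (Y k / r%:R) ^+ r <= c^-1 / 128 * k%:R ^- 2 * z ^+ (k * r).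
Proof.
move=> k_gt0 r_gt1 Tr.
have k_ge1 : 1 <= k%:R :> R by rewrite ler1n.
have k_gt0R : 0 < k%:R :> R by rewrite ltr0n.
have r_gt0 : 0 < r%:R :> R by rewrite ltr0n ltnW.
have zk_ge0 : 0 <= z ^+ k by rewrite exprn_ge0 // ltW.
have zk_le1 : z ^+ k <= 1 by rewrite exprn_ile1 // ltW.
have Y_ge0 : 0 <= Y k / r%:R.
  by rewrite /Y !(divr_ge0, mulr_ge0, exprn_ge0) // ltW.
have YE : Y k / r%:R = (z / c) / (16 * k%:R) * z ^+ k * (T / 2 ^+ k / r%:R).
  rewrite /Y expr_div_n; field.
  by rewrite !gt_eqF ?exprn_gt0.
have Tr8 : T / 2 ^+ k / r%:R <= 8 by rewrite ler_pdivrMr.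
have Y_le : Y k / r%:R <= (z / c) / (2 * k%:R) * z ^+ k.
  rewrite YE; apply: (@le_trans _ _ ((z / c) / (16 * k%:R) * z ^+ k * 8)).
    by rewrite ler_wpM2l // !(divr_ge0, mulr_ge0) // ltW.
  by rewrite le_eqVlt; apply/orP; left; apply/eqP; field; rewrite !gt_eqF.
have Y_le1 : Y k / r%:R <= (64 * k%:R)^-1 * z ^+ k.
  apply: le_trans Y_le _; rewrite ler_wpM2r //.
  have -> : (64 * k%:R)^-1 = 32^-1 / (2 * k%:R) :> R by field; rewrite gt_eqF.
  by rewrite ler_wpM2r // invr_ge0 mulr_ge0.
have Y_le2 : Y k / r%:R <= c^-1 / (2 * k%:R) * z ^+ k.
  apply: le_trans Y_le _; rewrite !ler_wpM2r ?invr_ge0 ?mulr_ge0 //.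
  by rewrite ler_piMl // invr_ge0 ltW.
have k64 : (64 * k%:R)^-1 <= 1 :> R by rewrite invf_le1; lra.
split.
  by apply: le_trans Y_le1 _; rewrite -[leRHS]mulr1 ler_pM // invr_ge0 mulr_ge0.
case: r r_gt1 {Tr r_gt0 YE Tr8 Y_le} Y_ge0 Y_le1 Y_le2 => [|[|r]] // _.
set y := Y k / _ => y_ge0 y_le1 y_le2; rewrite exprS.
apply: (@le_trans _ _ ((c^-1 / (2 * k%:R) * z ^+ k) *
                       ((64 * k%:R)^-1 * z ^+ (k * r.+1)))).
  apply: ler_pM => //; first exact: exprn_ge0.
  apply: (@le_trans _ _ (((64 * k%:R)^-1 * z ^+ k) ^+ r.+1)).
    by apply: lerXn2r => //; rewrite nnegrE // (le_trans y_ge0).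
  rewrite exprMn -exprM ler_wpM2r ?exprn_ge0 ?(ltW z_gt0) //.
  rewrite exprS ler_piMr ?exprn_ile1 ?invr_ge0 ?mulr_ge0 //.
rewrite [(k * r.+2)%N]mulnS exprD le_eqVlt; apply/orP; left; apply/eqP.
by field; rewrite !gt_eqF.
Qed.

(** The case of one star: after [T <= (16 k)^2] a factor [k] is left over, and the [2 ^- k] inside
    [Y k] absorbs it. *)
Lemma single_star_estimate (k : nat) : (0 < k)%N -> T <= 256 * k%:R ^+ 2 ->
  Y k <= 1 /\ Y k <= 16 / c * z ^+ k.
Proof.
move=> k_gt0 Tk.
have k_gt0R : 0 < k%:R :> R by rewrite ltr0n.
have zk_ge0 : 0 <= z ^+ k by rewrite exprn_ge0 // ltW.
have zk_le1 : z ^+ k <= 1 by rewrite exprn_ile1 // ltW.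
have p2_gt0 : 0 < 2 ^+ k :> R by rewrite exprn_gt0.
have k2 : k%:R / 2 ^+ k <= 1 :> R.
  by rewrite ler_pdivrMr // mul1r -natrX ler_nat ltnW // ltn_expl.
have zc_ge0 : 0 <= z / c by rewrite divr_ge0 // ltW.
have Y_le : Y k <= 16 * (z / c) * z ^+ k.
  have -> : Y k = (z / c) * z ^+ k * (T / (16 * k%:R * 2 ^+ k)).
    by rewrite /Y expr_div_n; field; rewrite !gt_eqF.
  rewrite [leRHS](_ : _ = z / c * z ^+ k * 16); last by ring.
  apply: ler_wpM2l; first exact: mulr_ge0.
  rewrite ler_pdivrMr ?mulr_gt0 //.
  apply: le_trans Tk _.
  have -> : 16 * (16 * k%:R * 2 ^+ k) = 256 * (k%:R * 2 ^+ k) :> R by ring.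
  rewrite ler_pM2l // expr2 ler_pM2l //.
  by move: k2; rewrite ler_pdivrMr // mul1r.
split; apply: le_trans Y_le _.
  rewrite -[leRHS]mulr1; apply: ler_pM => //; first exact: mulr_ge0.
  by apply: le_trans (ler_wpM2l _ zc_le) _; lra.
rewrite ler_wpM2r // ler_pM2l // ler_piMl // invr_ge0 ltW //.
Qed.

End Estimates.

(** * The two covers and the final bound *)

Lemma dense_family_edge_cover (R : realType) (V : finType) (G : {set {set V}})
    (J T p : R) : 0 < T -> covers G (dense_family J T p G).
Proof.
move=> T_gt0 U; rewrite inE ge_max => /andP[TU _].
have : 0 < #|induced_edges G U|%:R :> R by apply: lt_le_trans TU.
by rewrite ltr0n => /card_gt0P[e]; rewrite inE => /andP[eG eU]; exists e.
Qed.

Lemma cost_edges (R : realType) (V : finType) (G : {set {set V}}) (p : R) :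
  simple_graph G -> cost p G = #|G|%:R * p ^+ 2.
Proof.
move=> simpleG; rewrite /cost (eq_bigr (fun=> p ^+ 2)) => [|e /simpleG -> //].
by rewrite sumr_const mulr_natl.
Qed.

Lemma exprV_le_powRN (R : realType) (a x : R) (n : nat) : 1 <= a -> x <= n%:R ->
  a^-1 ^+ n <= a `^ (- x).
Proof.
move=> a_ge1 xn; rewrite exprVn -powR_mulrn ?(le_trans ler01) // -powRN.
by apply: ler_powR => //; rewrite lerN2.
Qed.

Lemma star_cover_large_T (R : realType) (V : finType) (G : {set {set V}})
    (p mu J c T J1 : R) :
  simple_graph G -> 0 <= p <= 1 -> #|G|%:R * p ^+ 2 <= mu ->
  8 * expR 1 <= J -> 256 * expR 1 / J <= c -> T = c * J ^+ 2 * mu ->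
  J1 = J / (8 * expR 1) -> 1024 <= T ->
  coverable p (dense_family J T p G) (32 * c^-1 * J1 `^ (- (Num.sqrt T / 16))).
Proof.
move=> simpleG p01 G_mu hJ hc hT hJ1 T_ge.
have p_ge0 : 0 <= p by case/andP: p01.
have e_ge2 := expR1_ge2 R.
set e := expR 1 in e_ge2 hJ hc hJ1 *.
have e_gt0 : 0 < e by lra.
have J_gt0 : 0 < J by apply: lt_le_trans hJ; lra.
have J4 : 4 * e <= J by lra.
have J1_ge1 : 1 <= J1 by rewrite hJ1 ler_pdivlMr ?mul1r // mulr_gt0.
have J1_gt0 : 0 < J1 by lra.
have JE : J = 8 * e * J1 by rewrite hJ1; field; rewrite gt_eqF.
have c_ge : 32 * J1^-1 <= c.
  by apply: le_trans hc; rewrite JE le_eqVlt; apply/orP; left; apply/eqP; field;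
    rewrite !gt_eqF.
have z_gt0 : 0 < J1^-1 by rewrite invr_gt0.
have z_le1 : J1^-1 <= 1 by rewrite invf_le1.
have c_gt0 : 0 < c by lra.
have T_ge0 : 0 <= T by lra.
set s := Num.sqrt T.
have s_sq : s ^+ 2 = T by rewrite sqr_sqrtr.
have s_ge0 : 0 <= s by exact: sqrtr_ge0.
have s_ge : 32 <= s by move: s_sq T_ge; rewrite expr2; nra.
pose n := Num.trunc (s / 16).
have s16_ge0 : 0 <= s / 16 by lra.
have n_le : n%:R <= s / 16 by rewrite truncn_le.
have n_lt : s / 16 < n.+1%:R by exact: truncnS_gt.
(* Index [i] stands for stars with at least [k = i + 1] leaves. The first term gives
   [T / 2 ^+ k <= 8 r]; the second gives [k * r >= s / 8], which yields the exponent [s / 16] and,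
   as [k <= s / 16], also [r >= 2]. *)
pose b (i : nat) : R := T / 8 / 2 ^+ i.+1 + s / 8 / i.+1%:R.
pose r (i : nat) := if (i < n)%N then (Num.trunc (b i)).+1 else 1%N.
have b_ge0 i : 0 <= b i by rewrite addr_ge0 // divr_ge0 ?exprn_ge0 //; lra.
(* The geometric part contributes at most [3 T / 8], the other at most [n * s / 4 <= T / 64]. *)
have sum_b : \sum_(i < n) (2 * i + 1)%N%:R * b i < T / 2.
  have -> : \sum_(i < n) (2 * i + 1)%N%:R * b i =
      T / 8 * (\sum_(i < n) (2 * i + 1)%N%:R / 2 ^+ i.+1) +
      \sum_(i < n) (2 * i + 1)%N%:R * (s / 8 / i.+1%:R).
    rewrite mulr_sumr -big_split /=; apply: eq_bigr => i _.
    by rewrite /b mulrDr; congr (_ + _); ring.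
  have le1 := ler_wpM2l (_ : 0 <= T / 8) (sum_odd_geometric R n).
  have le2 : \sum_(i < n) (2 * i + 1)%N%:R * (s / 8 / i.+1%:R) <= n%:R * (s / 4).
    have -> : n%:R * (s / 4) = \sum_(i < n) s / 4.
      by rewrite sumr_const card_ord mulr_natl.
    apply: ler_sum => i _.
    rewrite mulrA ler_pdivrMr ?ltr0n // [leRHS](_ : _ = (2 * i + 2)%N%:R * (s / 8)).
      by rewrite ler_wpM2r ?ler_nat ?leq_add2l //; lra.
    by rewrite natrD natrM -natr1; field.
  apply: le_lt_trans (lerD (le1 _) le2) _; first lra.
  have := ler_wpM2r (_ : 0 <= s / 4) n_le => /(_ _) le3.
  apply: (@le_lt_trans _ _ (T / 8 * 3 + s / 16 * (s / 4))).
    by rewrite lerD2l le3 //; lra.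
  have -> : s / 16 * (s / 4) = T / 64 by rewrite -s_sq; field.
  lra.
have r_min i m : (i < n)%N -> b i < m%:R -> (r i <= m)%N.
  by rewrite /r => -> ; rewrite -truncn_lt_nat.
have rn : (r n <= 1)%N by rewrite /r ltnn.
exists (\bigcup_(i < n.+1) star_unions G p J i.+1 (r i))%SET.
  exact: (star_unions_cover simpleG p01 J4 sum_b r_min rn).
apply: le_trans (cost_bigcup _ p_ge0) _.
(* Total cost of the heavy stars, with the edge term replaced by [mu]. Since [mu = T / (c J^2)] and
   [4e/J = J1^-1 / 2], multiplying by [e] gives the quantity of the estimates with [z = J1^-1]. *)
pose Y (k : nat) := 2 * e * mu / k%:R * (4 * e / J) ^+ k.-1.
have YE k : (0 < k)%N ->
    e * Y k = T * J1^-1 / (16 * c * k%:R) * (J1^-1 / 2) ^+ k.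
  case: k => // k _; rewrite /Y /= hT JE.
  have -> : 4 * e / (8 * e * J1) = J1^-1 / 2 by field; rewrite !gt_eqF.
  by rewrite [(J1^-1 / 2) ^+ k.+1]exprS; field; rewrite !gt_eqF.
have costY i : (0 < r i)%N -> e * Y i.+1 / (r i)%:R <= 1 ->
    cost p (star_unions G p J i.+1 (r i)) <= (e * Y i.+1 / (r i)%:R) ^+ r i.
  move=> r_gt0 Yr.
  have Y_ge0 : 0 <= Y i.+1.
    rewrite /Y mulr_ge0 ?exprn_ge0 ?divr_ge0 ?mulr_ge0 //; try lra.
    by apply: le_trans G_mu; rewrite mulr_ge0 ?exprn_ge0.
  apply: star_unions_cost => //.
    apply: le_trans (heavy_stars_cost simpleG p01 J4 _) _ => //.
    apply: ler_wpM2r; first by rewrite exprn_ge0 // divr_ge0 ?mulr_ge0 // ltW.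
    by apply: ler_wpM2r; [rewrite invr_ge0|rewrite ler_wpM2l // mulr_ge0 // ltW].
  move: Yr; rewrite ler_pdivrMr ?ltr0n // mul1r; apply: le_trans.
  by rewrite ler_peMl //; lra.
set P := J1 `^ _.
have P_ge0 : 0 <= P by exact: powR_ge0.
have cV_ge0 : 0 <= c^-1 by rewrite invr_ge0 ltW.
have cost_small (i : 'I_n) :
    cost p (star_unions G p J i.+1 (r i)) <= c^-1 / 128 * P * i.+1%:R ^- 2.
  have i_gt0 : 0 < i.+1%:R :> R by rewrite ltr0n.
  have i_le : i.+1%:R <= s / 16 by apply: le_trans n_le; rewrite ler_nat.
  have b_lt : b i < (r i)%:R by rewrite /r ltn_ord truncnS_gt.
  have b1 : T / 8 / 2 ^+ i.+1 <= (r i)%:R.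
    by apply/ltW/(le_lt_trans _ b_lt); rewrite /b lerDl divr_ge0 //; lra.
  have b2 : s / 8 / i.+1%:R <= (r i)%:R.
    by apply/ltW/(le_lt_trans _ b_lt); rewrite /b lerDr divr_ge0 ?exprn_ge0 //; lra.
  have r_gt1 : (1 < r i)%N.
    rewrite -(ltr_nat R); apply: lt_le_trans b2.
    by rewrite ltr_pdivlMr // mul1r; lra.
  have Tr : T / 2 ^+ i.+1 <= 8 * (r i)%:R.
    by rewrite -ler_pdivrMl // mulrC mulrAC.
  have [est1 est2] :=
    many_stars_estimate z_gt0 z_le1 c_ge T_ge0 (ltn0Sn i) r_gt1 Tr.
  rewrite -YE // in est1 est2.
  apply: le_trans (costY _ (ltnW r_gt1) est1) _.
  apply: le_trans est2 _.
  rewrite [leRHS]mulrAC; apply: ler_wpM2l.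
    by rewrite mulr_ge0 ?invr_ge0 ?exprn_ge0 // mulr_ge0.
  apply: exprV_le_powRN => //; rewrite natrM.
  by move: b2; rewrite ler_pdivrMr //; lra.
(* Both needs of the single-star case, [T <= 256 k^2] and an exponent of at least [s / 16], follow
   from [k = n + 1 > s / 16]. *)
have cost_large : cost p (star_unions G p J n.+1 (r n)) <= 16 / c * P.
  have Tn : T <= 256 * n.+1%:R ^+ 2.
    rewrite -s_sq [leRHS](_ : _ = (16 * n.+1%:R) ^+ 2); last by ring.
    by apply: lerXn2r; rewrite ?nnegrE ?mulr_ge0 //; lra.
  have [est1 est2] :=
    single_star_estimate z_gt0 z_le1 c_ge (ltn0Sn n) Tn.
  rewrite -YE // in est1 est2.
  have := costY n; rewrite /r ltnn divr1 expr1 => /(_ isT est1) /le_trans; apply.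
  apply: le_trans est2 _; apply: ler_wpM2l; first by rewrite mulr_ge0.
  by apply: exprV_le_powRN => //; exact: ltW.
rewrite big_ord_recr /=; apply: le_trans (lerD (ler_sum _ _) cost_large) _.
  by move=> i _; exact: cost_small.
rewrite -mulr_sumr.
have := ler_wpM2l (_ : 0 <= c^-1 / 128 * P) (sum_inv_squares R n).
move=> /(_ _) le4; apply: le_trans (lerD (le4 _) (lexx _)) _.
  by rewrite mulr_ge0 // mulr_ge0.
have : 0 <= c^-1 * P by rewrite mulr_ge0.
rewrite [32 * c^-1 * P](_ : _ = 32 * (c^-1 * P)); last by ring.
have -> : c^-1 / 128 * P * 2 + 16 / c * P = (64^-1 + 16) * (c^-1 * P).
  by field; rewrite gt_eqF.
lra.
Qed.

Theorem theorem2p2 (R : realType) (mu J c T J1 : R)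
  (hmu : 0 < mu)
  (hJ : 8 * expR 1 <= J)
  (hc : 256 * expR 1 / J <= c)
  (hT : T = c * J ^+ 2 * mu)
  (hJ1 : J1 = J / (8 * expR 1)) :
  (Cstar J mu T
     <= (32 * c^-1 * Num.min (J1 ^- 2) (J1 `^ (- (Num.sqrt T / 16))))%:E)%E.
Proof.
have e_ge2 := expR1_ge2 R.
have e_gt0 : 0 < expR 1 :> R by exact: expR_gt0.
have J_gt0 : 0 < J by apply: lt_le_trans hJ; rewrite mulr_gt0.
have c_gt0 : 0 < c by apply: lt_le_trans hc; rewrite divr_gt0 ?mulr_gt0.
have J1_ge1 : 1 <= J1 by rewrite hJ1 ler_pdivlMr ?mul1r // mulr_gt0.
have J1_ge0 : 0 <= J1 by apply: le_trans J1_ge1.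
have T_gt0 : 0 < T by rewrite hT !mulr_gt0 ?exprn_gt0.
have cV_ge0 : 0 <= 32 * c^-1 by rewrite mulr_ge0 // invr_ge0 ltW.
have J1N2 : J1 ^- 2 = J1 `^ (- 2) by rewrite powRN powR_mulrn.
have sqrt1024 : Num.sqrt 1024 = 32 :> R.
  have -> : 1024 = 32 ^+ 2 :> R by rewrite expr2 -natrM.
  by rewrite sqrtr_sqr ger0_norm.
apply: ereal_inf_lbound; exists (32 * c^-1 *
  Num.min (J1 ^- 2) (J1 `^ (- (Num.sqrt T / 16)))) => //= V p G p01 simpleG G_mu.
(* At [T = 1024] the exponent [sqrt T / 16] equals 2, so the minimum switches between its two terms
   there. *)
have [T_le|T_gt] := leP T 1024.
  exists G; first exact: dense_family_edge_cover.
  rewrite cost_edges //; apply: le_trans G_mu _.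
  have sqrtT : Num.sqrt T <= 32 by rewrite -sqrt1024 ler_wsqrtr.
  rewrite min_l; last by rewrite J1N2; apply: ler_powR => //; lra.
  (* In terms of [J1], [mu] is [T / (64 e^2 c J1^2)], which is within the bound as long as
     [T <= 2048 e^2]. *)
  have -> : mu = T * (c^-1 * (64 * expR 1 ^+ 2)^-1 * J1 ^- 2).
    by rewrite hT hJ1; field; rewrite !gt_eqF.
  have -> : 32 * c^-1 * J1 ^- 2 =
      (2048 * expR 1 ^+ 2) * (c^-1 * (64 * expR 1 ^+ 2)^-1 * J1 ^- 2).
    by field; rewrite !gt_eqF // (lt_le_trans ltr01).
  apply: ler_wpM2r.
    by rewrite !mulr_ge0 ?invr_ge0 ?mulr_ge0 ?exprn_ge0 // ltW.
  by apply: le_trans T_le _; rewrite expr2; nra.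
have sqrtT : 32 <= Num.sqrt T by rewrite -sqrt1024 ler_wsqrtr // ltW.
rewrite min_r; last by rewrite J1N2; apply: ler_powR => //; lra.
exact: star_cover_large_T simpleG p01 G_mu hJ hc hT hJ1 (ltW T_gt).
Qed.
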